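(* Let $\mathbf A\in\mathbb H^{n\times n}$ be diagonalizable. Then the left system $\mathbf x'=\mathbf x\mathbf A$ has the general solution $$\mathbf x_{gen}(t)=q_1e^{\lambda_1t}\mathbf v_1+\dots+q_ne^{\lambda_nt}\mathbf v_n,$$ where $\{\mathbf v_1,\dots,\mathbf v_n\}$ is a set of left linearly independent row eigenvectors of $\mathbf A$ with corresponding eigenvalues $\lambda_1,\dots,\lambda_n$ (that is, $\mathbf v_i\mathbf A=\lambda_i\mathbf v_i$), and $q_1,\dots,q_n\in\mathbb H$ are arbitrary constants. Furthermore, every initial value problem $\mathbf x'=\mathbf x\mathbf A$, $\mathbf x(t_0)=\mathbf x_0$ ($t_0\in\mathbb R$) has a unique solution for every initial condition $\mathbf x_0\in\mathbb H^{1\times n}$, where the constants $q_1,\dots,q_n$ are a solution of the algebraic linear system $$\mathbf x_0=q_1e^{\lambda_1t_0}\mathbf v_1+\dots+q_ne^{\lambda_nt_0}\mathbf v_n,$$ and this solution is given by $$\mathbf x(t)=\mathbf x_0\mathbf X_l^{-1}(t_0)\mathbf X_l(t),$$ where $\mathbf X_l(t)=\begin{bmatrix} e^{\lambda_1t}\mathbf v_1 \\ \vdots \\ e^{\lambda_nt}\mathbf v_n \end{bmatrix}$ is a fundamental matrix of the system.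
   Context: $\mathbb H$ is the real quaternion skew field; derivatives in the real variable $t$ are componentwise; $e^{q}=\sum_{m\ge 0}q^m/m!$ for $q\in\mathbb H$. $\mathbf A$ is diagonalizable if $\mathbf A=\mathbf P\mathbf D\mathbf P^{-1}$ for some invertible $\mathbf P$ and diagonal $\mathbf D$ in $\mathbb H^{n\times n}$. Here an eigenvalue is $\lambda\in\mathbb H$ with $\mathbf v\mathbf A=\lambda\mathbf v$ for some nonzero row $\mathbf v$, called a corresponding row eigenvector. Row vectors form a left $\mathbb H$-vector space. A fundamental matrix of $\mathbf x'=\mathbf x\mathbf A$ is a matrix whose rows are left linearly independent solutions (no constants $q_i\in\mathbb H$, not all zero, satisfy $\sum_iq_i\mathbf x_i(t)=\mathbf 0$ for all $t$); ''general solution'' means that the functions of the given form, as the constants $q_i$ range over $\mathbb H$, are exactly the solutions. *)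

(* Defs.v *)
From HB Require Import structures.
From mathcomp Require Import all_boot all_order all_algebra.
From mathcomp Require Import ring lra.
From mathcomp Require Import all_classical all_reals all_analysis.

Set Implicit Arguments.
Unset Strict Implicit.
Unset Printing Implicit Defensive.

Import Order.TTheory GRing.Theory Num.Theory.
Import numFieldNormedType.Exports.

Local Open Scope classical_set_scope.
Local Open Scope ring_scope.

(* a + b i + c j + d k is the row vector (a, b, c, d); the topology and the
   real vector space structure are those of R^4. *)
Definition quat (R : realType) : Type := 'rV[R]_4.

HB.instance Definition _ (R : realType) :=
  NormedModule.copy (quat R) 'rV[R]_4.
HB.instance Definition _ (R : realType) := Complete.copy (quat R) 'rV[R]_4.

Definition Quat {R : realType} (a b c d : R) : quat R :=
  \row_(k < 4) nth 0 [:: a; b; c; d] k.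

Definition qcoord {R : realType} (k : 'I_4) (q : quat R) : R :=
  (q : 'rV[R]_4) ord0 k.

Section QuatRing.
Variable R : realType.
Implicit Types p q : quat R.

Definition qre q : R := qcoord (@Ordinal 4 0 isT) q.
Definition qi q : R := qcoord (@Ordinal 4 1 isT) q.
Definition qj q : R := qcoord (@Ordinal 4 2 isT) q.
Definition qk q : R := qcoord (@Ordinal 4 3 isT) q.

Definition mulq p q : quat R := Quat
  (qre p * qre q - qi p * qi q - qj p * qj q - qk p * qk q)
  (qre p * qi q + qi p * qre q + qj p * qk q - qk p * qj q)
  (qre p * qj q - qi p * qk q + qj p * qre q + qk p * qi q)
  (qre p * qk q + qi p * qj q - qj p * qi q + qk p * qre q).

Definition oneq : quat R := Quat 1 0 0 0.

Lemma qreE a b c d : qre (Quat a b c d : quat R) = a.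
Proof. by rewrite /qre /qcoord mxE. Qed.
Lemma qiE a b c d : qi (Quat a b c d : quat R) = b.
Proof. by rewrite /qi /qcoord mxE. Qed.
Lemma qjE a b c d : qj (Quat a b c d : quat R) = c.
Proof. by rewrite /qj /qcoord mxE. Qed.
Lemma qkE a b c d : qk (Quat a b c d : quat R) = d.
Proof. by rewrite /qk /qcoord mxE. Qed.

Lemma qreD p q : qre (p + q) = qre p + qre q.
Proof. by rewrite /qre /qcoord mxE. Qed.
Lemma qiD p q : qi (p + q) = qi p + qi q.
Proof. by rewrite /qi /qcoord mxE. Qed.
Lemma qjD p q : qj (p + q) = qj p + qj q.
Proof. by rewrite /qj /qcoord mxE. Qed.
Lemma qkD p q : qk (p + q) = qk p + qk q.
Proof. by rewrite /qk /qcoord mxE. Qed.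

Lemma qreZ (a : R) q : qre (a *: q) = a * qre q.
Proof. by rewrite /qre /qcoord mxE. Qed.
Lemma qiZ (a : R) q : qi (a *: q) = a * qi q.
Proof. by rewrite /qi /qcoord mxE. Qed.
Lemma qjZ (a : R) q : qj (a *: q) = a * qj q.
Proof. by rewrite /qj /qcoord mxE. Qed.
Lemma qkZ (a : R) q : qk (a *: q) = a * qk q.
Proof. by rewrite /qk /qcoord mxE. Qed.

Definition qE :=
  (qreE, qiE, qjE, qkE, qreD, qiD, qjD, qkD, qreZ, qiZ, qjZ, qkZ).

Lemma quatP p q :
  qre p = qre q -> qi p = qi q -> qj p = qj q -> qk p = qk q -> p = q.
Proof.
move=> h0 h1 h2 h3; apply/rowP => k.
by case: k => [[|[|[|[|//]]]]] h; rewrite (bool_irrelevance h isT).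
Qed.

Lemma mulqA : associative mulq.
Proof. by move=> p q r; apply: quatP; rewrite /mulq !qE; ring. Qed.
Lemma mul1q : left_id oneq mulq.
Proof. by move=> p; apply: quatP; rewrite /mulq /oneq !qE; ring. Qed.
Lemma mulq1 : right_id oneq mulq.
Proof. by move=> p; apply: quatP; rewrite /mulq /oneq !qE; ring. Qed.
Lemma mulqDl : left_distributive mulq +%R.
Proof. by move=> p q r; apply: quatP; rewrite /mulq !qE; ring. Qed.
Lemma mulqDr : right_distributive mulq +%R.
Proof. by move=> p q r; apply: quatP; rewrite /mulq !qE; ring. Qed.
Lemma oneq_neq0 : oneq != 0.
Proof.
apply/eqP => /(congr1 qre); rewrite /oneq qE /qre /qcoord mxE.
by apply/eqP; rewrite oner_eq0.
Qed.

HB.instance Definition _ := GRing.Zmodule_isNzRing.Build (quat R)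
  mulqA mul1q mulq1 mulqDl mulqDr oneq_neq0.

Lemma scaleqAl (a : R) p q : a *: (p * q) = (a *: p) * q.
Proof. by apply: quatP; rewrite /GRing.mul /= /mulq !qE; ring. Qed.
HB.instance Definition _ := GRing.Lmodule_isLalgebra.Build R (quat R) scaleqAl.

Lemma scaleqAr (a : R) p q : a *: (p * q) = p * (a *: q).
Proof. by apply: quatP; rewrite /GRing.mul /= /mulq !qE; ring. Qed.
HB.instance Definition _ := GRing.Lalgebra_isAlgebra.Build R (quat R) scaleqAr.

Definition qnormsq q : R := qre q ^+ 2 + qi q ^+ 2 + qj q ^+ 2 + qk q ^+ 2.
Definition qconj q : quat R := Quat (qre q) (- qi q) (- qj q) (- qk q).
Definition invq q : quat R := (qnormsq q)^-1 *: qconj q.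

Lemma qnormsq_eq0 q : (qnormsq q == 0) = (q == 0).
Proof.
apply/eqP/eqP => [|->]; last first.
  by rewrite /qnormsq /qre /qi /qj /qk /qcoord !mxE expr0n !addr0.
move=> h; have [h0 h1 h2 h3] :
    [/\ qre q = 0, qi q = 0, qj q = 0 & qk q = 0].
  move: h; rewrite /qnormsq => h.
  have := (sqr_ge0 (qre q), sqr_ge0 (qi q), sqr_ge0 (qj q), sqr_ge0 (qk q)).
  move=> [[[a0 a1] a2] a3].
  by split; apply/eqP; rewrite -sqrf_eq0; apply/eqP; lra.
by apply: quatP; rewrite ?(h0, h1, h2, h3) /qre /qi /qj /qk /qcoord mxE.
Qed.

Lemma mulVq : {in [pred q | q != 0], left_inverse 1 invq *%R}.
Proof.
move=> q; rewrite inE -qnormsq_eq0 => hq.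
have := mulVf hq; rewrite /invq; set c := _^-1; rewrite /qnormsq => hc.
apply: quatP; rewrite /GRing.mul /GRing.one /= /mulq /oneq !qE;
  [by rewrite -hc; ring | ring | ring | ring].
Qed.
Lemma mulqV : {in [pred q | q != 0], right_inverse 1 invq *%R}.
Proof.
move=> q; rewrite inE -qnormsq_eq0 => hq.
have := mulVf hq; rewrite /invq; set c := _^-1; rewrite /qnormsq => hc.
apply: quatP; rewrite /GRing.mul /GRing.one /= /mulq /oneq !qE;
  [by rewrite -hc; ring | ring | ring | ring].
Qed.
Lemma unitq p q : q * p = 1 /\ p * q = 1 -> p \in [pred q : quat R | q != 0].
Proof.
move=> [_ pq1]; rewrite inE; apply/eqP => p0.
by move: pq1; rewrite p0 mul0r => /eqP; rewrite eq_sym oner_eq0.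
Qed.
Lemma invq_out : {in [predC [pred q : quat R | q != 0]], invq =1 id}.
Proof.
move=> q; rewrite !inE negbK => /eqP ->.
have /eqP h : qnormsq 0 == 0 by rewrite qnormsq_eq0.
by rewrite /invq h invr0 scale0r.
Qed.
HB.instance Definition _ := GRing.NzRing_hasMulInverse.Build (quat R)
  mulVq mulqV unitq invq_out.

End QuatRing.

Section QuatExp.
Variable R : realType.
Implicit Types p q : quat R.

Definition expq_coeff q : (quat R)^nat := fun m => m`!%:R^-1 *: q ^+ m.

Definition expq q : quat R := limn (series (expq_coeff q)).

Lemma ler_qcoord k q : `|qcoord k q| <= `|q|.
Proof.
rewrite [leRHS]mx_normrE.
exact: (le_bigmax _ (fun ij => `|(q : 'rV[R]_4) ij.1 ij.2|) (ord0, k)).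
Qed.

Lemma ler_normq q (c : R) :
  0 <= c -> (forall k, `|qcoord k q| <= c) -> `|q| <= c.
Proof.
move=> c0 h; rewrite [leLHS]mx_normrE; apply: bigmax_le => // -[i k] _ /=.
by have := h k; rewrite /qcoord (ord1 i).
Qed.

Lemma ler_normqM p q : `|p * q| <= 4 * `|p| * `|q|.
Proof.
have H (a b : 'I_4) :
    - (`|p| * `|q|) <= qcoord a p * qcoord b q <= `|p| * `|q|.
  by rewrite -ler_norml normrM ler_pM ?ler_qcoord.
apply: ler_normq => [|k]; first by rewrite !mulr_ge0.
rewrite ler_norml -mulrA; set c := `|p| * `|q| in H *.
pose i0 := @Ordinal 4 0 isT; pose i1 := @Ordinal 4 1 isT.
pose i2 := @Ordinal 4 2 isT; pose i3 := @Ordinal 4 3 isT.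
have := (H i0 i0, H i0 i1, H i0 i2, H i0 i3).
have := (H i1 i0, H i1 i1, H i1 i2, H i1 i3).
have := (H i2 i0, H i2 i1, H i2 i2, H i2 i3).
have := (H i3 i0, H i3 i1, H i3 i2, H i3 i3).
move=> [[[h30 h31] h32] h33] [[[h20 h21] h22] h23].
move=> [[[h10 h11] h12] h13] [[[h00 h01] h02] h03].
have -> : p * q = mulq p q by [].
case: k => [[|[|[|[|//]]]]] lt_k; rewrite (bool_irrelevance lt_k isT).
- rewrite -[qcoord _ _]/(qre (mulq p q)) qreE
    /qre /qi /qj /qk -/i0 -/i1 -/i2 -/i3.
  lra.
- rewrite -[qcoord _ _]/(qi (mulq p q)) qiE
    /qre /qi /qj /qk -/i0 -/i1 -/i2 -/i3.
  lra.
- rewrite -[qcoord _ _]/(qj (mulq p q)) qjE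
    /qre /qi /qj /qk -/i0 -/i1 -/i2 -/i3.
  lra.
- rewrite -[qcoord _ _]/(qk (mulq p q)) qkE
    /qre /qi /qj /qk -/i0 -/i1 -/i2 -/i3.
  lra.
Qed.

Lemma is_cvg_series_expq_coeff q : cvgn (series (expq_coeff q)).
Proof.
apply: normed_cvg.
apply: series_le_cvg; last exact: (is_cvg_series_exp_coeff (4 * `|q|)).
- by move=> n; rewrite normr_ge0.
- by move=> n; rewrite divr_ge0 // exprn_ge0 // mulr_ge0.
move=> n /=; rewrite /exp_coeff /expq_coeff /= normrZ mulrC.
rewrite ger0_norm ?invr_ge0 ?ler0n // ler_wpM2r ?invr_ge0 ?ler0n //.
elim: n => [|n IH]; last first.
  rewrite !exprS (le_trans (ler_normqM _ _)) // ler_pM // mulr_ge0 //.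
rewrite !expr0; apply: ler_normq => // k; rewrite /GRing.one /= /oneq /qcoord.
rewrite mxE; case: k => [[|[|[|[|//]]]]] lt_k /=.
all: by rewrite ?normr1 ?normr0.
Qed.

End QuatExp.

Section LeftSystems.
Variables (R : realType) (n : nat).
Implicit Types (A X Y : 'M[quat R]_n) (x : R -> 'rV[quat R]_n).

(* unitmx is restricted to commutative rings. *)
Definition is_inverse_mx X Y : Prop := X *m Y = 1%:M /\ Y *m X = 1%:M.

Definition diagonalizable_mx A : Prop := exists P Q D : 'M[quat R]_n,
  [/\ is_inverse_mx P Q, is_diag_mx D & A = P *m D *m Q].

(* Scalars act on row vectors from the left: (q *: v) 0 j = q * v 0 j. *)
Definition row_eigenvector A (lambda : quat R) (v : 'rV[quat R]_n) : Prop :=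
  v != 0 /\ v *m A = lambda *: v.

Definition left_independent (v : 'I_n -> 'rV[quat R]_n) : Prop :=
  forall q : 'I_n -> quat R,
    \sum_(i < n) q i *: v i = 0 -> forall i, q i = 0.

Definition left_independent_fun (x : 'I_n -> R -> 'rV[quat R]_n) : Prop :=
  forall q : 'I_n -> quat R,
    (forall t, \sum_(i < n) q i *: x i t = 0) -> forall i, q i = 0.

Definition has_derivative x (t : R) (dx : 'rV[quat R]_n) : Prop :=
  forall (j : 'I_n) (k : 'I_4),
    is_derive t 1 (fun s : R => qcoord k (x s ord0 j)) (qcoord k (dx ord0 j)).

Definition left_solution A x : Prop :=
  forall t : R, has_derivative x t (x t *m A).

Definition left_ivp_solution A (t0 : R) (x0 : 'rV[quat R]_n) x : Prop :=
  left_solution A x /\ x t0 = x0.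

Definition fundamental_matrix A (X : R -> 'M[quat R]_n) : Prop :=
  (forall i, left_solution A (fun t => row i (X t))) /\
  left_independent_fun (fun i t => row i (X t)).

Definition exp_mx (lambda : 'I_n -> quat R) (v : 'I_n -> 'rV[quat R]_n)
    (t : R) : 'M[quat R]_n :=
  \matrix_(i < n) (expq (t *: lambda i) *: v i).

Definition exp_comb (lambda : 'I_n -> quat R) (v : 'I_n -> 'rV[quat R]_n)
    (q : 'I_n -> quat R) (t : R) : 'rV[quat R]_n :=
  \sum_(i < n) (q i * expq (t *: lambda i)) *: v i.

End LeftSystems.

(* Main.v *)
Require Import Defs.
From HB Require Import structures.
From mathcomp Require Import all_boot all_order all_algebra.
From mathcomp Require Import all_classical all_reals all_analysis.

Import Order.TTheory GRing.Theory Num.Theory.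
Import numFieldNormedType.Exports.

Local Open Scope ring_scope.

(** Let V be the matrix with rows v_i and Lambda the diagonal matrix of the
    lambda_i, so that V A = Lambda V. Once V is known to have a two-sided
    inverse W, the coordinates y = x W of a solution x satisfy
    y' = x A W = y Lambda: the system splits into the scalar equations
    y_i' = y_i lambda_i. Each of these is solved by the integrating factor
    e^(-lambda t): multiplied on the right by it, y_i has derivative zero,
    hence y_i(t) = y_i(0) e^(lambda_i t) ([scalar_ode_sol]), and x = y V is an
    exponential combination of the eigenvectors ([solution_exp_comb]). The
    converse is differentiation ([exp_comb_solution]).

    The analysis is done on the four real coordinates. A coordinate of
    e^(lambda t) is a real power series in t that converges everywhere, and
    termwise differentiation gives (e^(lambda t))' = lambda e^(lambda t)
    ([is_qderive_expq]); the Leibniz rule follows from the structure constants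
    of the algebra ([qcoordM]).

    The linear algebra is over a skew field, where determinants and ranks of
    commutative matrix theory do not apply. Right multiplication by V is
    however an injective real linear map of a space of dimension 4 n, hence
    bijective, which produces W ([row_kernel0_inverse]). The same lemma inverts
    the matrix with rows e^(lambda_i t0) v_i, since the e^(lambda_i t0) are
    invertible quaternions; existence and uniqueness for initial value problems
    and the formula x0 X(t0)^-1 X(t) are then matrix identities. *)

(** * Differentiation of quaternion-valued functions *)

Section QuatDerivative.
Set Implicit Arguments.
Unset Strict Implicit.
Context {R : realType}.
Implicit Types (p q r l : quat R) (f g : R -> quat R) (t : R).

Lemma qcoord_is_linear (k : 'I_4) : linear (@qcoord R k : quat R -> R^o).
Proof. by move=> a p q; rewrite /qcoord !mxE. Qed.
HB.instance Definition _ k :=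
  GRing.isLinear.Build R (quat R) R^o *:%R (@qcoord R k) (qcoord_is_linear k).

Lemma qcoord_eq p q : (forall k, qcoord k p = qcoord k q) -> p = q.
Proof. by move=> pq; apply/rowP => k; exact: pq. Qed.

Definition qbasis (i : 'I_4) : quat R := (delta_mx 0 i : 'rV[R]_4).

Lemma quat_basis q : q = \sum_i qcoord i q *: qbasis i.
Proof. exact: row_sum_delta. Qed.

(** The structure constants of the basis 1, i, j, k: they reduce bilinearity
    arguments to real products, uniformly in the four coordinates. *)
Lemma qcoordM k p q : qcoord k (p * q) =
  \sum_i \sum_j qcoord i p * qcoord j q * qcoord k (qbasis i * qbasis j).
Proof.
rewrite {1}(quat_basis p) {1}(quat_basis q) mulr_suml linear_sum.
apply: eq_bigr => i _; rewrite mulr_sumr linear_sum; apply: eq_bigr => j _.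
by rewrite -scalerAl -scalerAr !linearZ /= /GRing.scale /= mulrA.
Qed.

(** Coordinatewise, so that [has_derivative] is entrywise [is_qderive] by
    conversion. *)
Definition is_qderive f t (df : quat R) : Prop :=
  forall k, is_derive t 1 (fun s : R => qcoord k (f s)) (qcoord k df).

Lemma is_qderive_cst q t : is_qderive (fun=> q) t 0.
Proof. by move=> k; rewrite linear0; exact: is_derive_cst. Qed.

(** The order of the factors is kept: quaternions do not commute. *)
Lemma is_qderiveM f g t df dg : is_qderive f t df -> is_qderive g t dg ->
  is_qderive (fun s => f s * g s) t (df * g t + f t * dg).
Proof.
move=> Df Dg k.
have -> : (fun s => qcoord k (f s * g s)) = \sum_i \sum_j
    (qcoord k (qbasis i * qbasis j) \*: ((qcoord i \o f) * (qcoord j \o g))).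
  apply/funext => s; rewrite qcoordM fct_sumE; apply: eq_bigr => i _.
  by rewrite fct_sumE; apply: eq_bigr => j _; rewrite mulrC.
rewrite linearD /= !qcoordM -big_split /=.
apply: is_derive_sum => i; rewrite -big_split /=; apply: is_derive_sum => j.
have Di : is_derive t 1 (qcoord i \o f) (qcoord i df) by exact: Df.
have Dj : is_derive t 1 (qcoord j \o g) (qcoord j dg) by exact: Dg.
apply: is_derive_eq; rewrite /GRing.scale /= -mulrDl mulrC; congr (_ * _).
by rewrite addrC [X in X + _]mulrC.
Qed.

Lemma is_qderive_sum m (f : 'I_m -> R -> quat R) t (df : 'I_m -> quat R) :
  (forall i, is_qderive (f i) t (df i)) ->
  is_qderive (fun s => \sum_i f i s) t (\sum_i df i).
Proof.
move=> Df k; rewrite linear_sum /=.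
have -> : (fun s => qcoord k (\sum_i f i s)) =
    \sum_i (fun s => qcoord k (f i s)).
  by apply/funext => s; rewrite linear_sum fct_sumE.
by apply: is_derive_sum => i; exact: Df.
Qed.

Lemma is_qderive0_cst f : (forall t, is_qderive f t 0) -> forall s t, f s = f t.
Proof.
move=> Df s t; apply: qcoord_eq => k.
apply: (@is_derive_0_is_cst R (fun u => qcoord k (f u))) => u.
by have := Df u k; rewrite linear0.
Qed.

(** * The exponential and scalar equations *)

Lemma continuous_qmul p r : continuous (fun q => p * q * r).
Proof.
move=> q; apply/(@cvgrPdist_le _ (quat R) _ (nbhs q)) => e e0.
(* The bound |p q| <= 4 |p| |q| is used twice, hence 16; adding 1 makes the
   Lipschitz constant positive. *)
have c0 : 0 < 16 * `|p| * `|r| + 1 by rewrite ltr_wpDl // !mulr_ge0.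
near=> s; rewrite -mulrBl -mulrBr.
have le_s : `|q - s| <= e / (16 * `|p| * `|r| + 1).
  near: s; apply: (@cvgr_dist_le _ (quat R) _ (nbhs q)) => //.
  exact: divr_gt0.
apply: (@le_trans _ _ ((16 * `|p| * `|r| + 1) * `|q - s|)); last first.
  by rewrite mulrC -ler_pdivlMr.
apply: (@le_trans _ _ (16 * `|p| * `|r| * `|q - s|)); last first.
  by rewrite ler_wpM2r // lerDl.
apply: (le_trans (ler_normqM _ _)).
have -> : 16 * `|p| * `|r| * `|q - s| = 4 * (4 * `|p| * `|q - s|) * `|r|.
  rewrite -[16]/(4 * 4)%:R natrM -!mulrA.
  by congr (_ * (_ * (_ * _))); exact: mulrC.
by rewrite ler_wpM2r // ler_wpM2l // ler_normqM.
Unshelve. all: by end_near. Qed.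

(** The power series in t of a coordinate of p e^(l t) r. Multipliers on both
    sides make this family stable under differentiation, which multiplies p
    by l, and let l be moved from one side of the exponential to the other. *)
Definition expq_pcoeff k p l r : R^nat :=
  fun m => m`!%:R^-1 * qcoord k (p * l ^+ m * r).

Lemma cvg_pseries_expq k p l r t :
  (pseries (expq_pcoeff k p l r) t @ \oo -->
     qcoord k (p * expq (t *: l) * r))%classic.
Proof.
have -> : pseries (expq_pcoeff k p l r) t =
    (fun q => qcoord k (p * q * r)) \o series (expq_coeff (t *: l)).
  apply/funext => n; rewrite /pseries /series /= mulr_sumr mulr_suml linear_sum.
  apply: eq_bigr => m _; rewrite /expq_coeff /expq_pcoeff exprZn scalerA.
  by rewrite -scalerAr -[_ *: _ * r]scalerAl [RHS]linearZ /= mulrAC.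
apply: continuous_cvg; last exact: is_cvg_series_expq_coeff.
apply: continuous_comp; first exact: continuous_qmul.
exact: coord_continuous.
Qed.

Lemma pseries_diffs_expq k p l r :
  pseries_diffs (expq_pcoeff k p l r) = expq_pcoeff k (p * l) l r.
Proof.
apply/funext => m; rewrite /pseries_diffs /expq_pcoeff factS natrM invfM.
by rewrite !mulrA mulfV ?pnatr_eq0 // mul1r exprS !mulrA.
Qed.

(** Since l l^m = l^m l, both sides are sums of the same power series. *)
Lemma expq_comm l t : l * expq (t *: l) = expq (t *: l) * l.
Proof.
apply: qcoord_eq => k.
rewrite -[l * _]mulr1 -[expq _ * _]mul1r mulrA.
have := @cvg_pseries_expq k l l 1 t; have := @cvg_pseries_expq k 1 l l t.
have -> : expq_pcoeff k l l 1 = expq_pcoeff k 1 l l.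
  by apply/funext => m; rewrite /expq_pcoeff mulr1 mul1r -exprS -exprSr.
by move=> /cvg_lim <- // /cvg_lim <-.
Qed.

(** Termwise differentiation at t of a power series converging everywhere, in
    particular at the point |t| + 1 beyond |t|. *)
Lemma is_qderive_expq l t :
  is_qderive (fun s => expq (s *: l)) t (l * expq (t *: l)).
Proof.
move=> k.
have E p s : qcoord k (p * expq (s *: l)) =
    limn (pseries (expq_pcoeff k p l 1) s).
  by apply/esym/cvg_lim => //; rewrite -[p * _]mulr1; exact: cvg_pseries_expq.
have -> : (fun s => qcoord k (expq (s *: l))) =
    (fun s => limn (pseries (expq_pcoeff k 1 l 1) s)).
  by apply/funext => s; rewrite -E mul1r.
rewrite E.
have -> : expq_pcoeff k l l 1 = pseries_diffs (expq_pcoeff k 1 l 1).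
  by rewrite pseries_diffs_expq mul1r.
apply: (@pseries_snd_diffs _ _ (`|t| + 1)); rewrite ?pseries_diffs_expq.
- by apply/cvg_ex; eexists; exact: cvg_pseries_expq.
- by apply/cvg_ex; eexists; exact: cvg_pseries_expq.
- by apply/cvg_ex; eexists; exact: cvg_pseries_expq.
by rewrite [ltRHS]ger0_norm ?ltrDl // addr_ge0.
Qed.

Lemma expq0 : expq (0 : quat R) = 1.
Proof.
apply: lim_near_cst => //; near=> m.
rewrite -[m]prednK; last by near: m.
rewrite /series /= big_nat_recl //= /expq_coeff expr0 fact0 invr1 scale1r.
by rewrite big1 ?addr0 // => i _; rewrite expr0n scaler0.
Unshelve. all: by end_near. Qed.

(** The integrating factor: the derivative is f l e - f l e = 0, with
    e = e^(- l t), because the derivative of e may be written - l e. *)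
Lemma scalar_ode_cst l f : (forall t, is_qderive f t (f t * l)) ->
  forall t, f t * expq (t *: - l) = f 0.
Proof.
move=> Df t; rewrite -[RHS]mulr1 -expq0 -[in RHS](scale0r (- l)).
apply: (@is_qderive0_cst (fun s => f s * expq (s *: - l))) => s.
have := is_qderiveM (Df s) (is_qderive_expq (- l) s).
by rewrite mulNr mulrN -!mulrA subrr.
Qed.

(** The case f(t) = e^(- l t) of [scalar_ode_cst], with - l for l; it stands in
    for the addition formula of the exponential. *)
Lemma expqNl l t : expq (t *: - l) * expq (t *: l) = 1.
Proof.
have := @scalar_ode_cst (- l) (fun s => expq (s *: - l)).
rewrite opprK scale0r expq0; apply => s.
by rewrite -expq_comm; exact: is_qderive_expq.
Qed.

Lemma scalar_ode_sol l f : (forall t, is_qderive f t (f t * l)) ->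
  forall t, f t = f 0 * expq (t *: l).
Proof. by move=> Df t; rewrite -(scalar_ode_cst Df t) -mulrA expqNl mulr1. Qed.

End QuatDerivative.

(** * Inverses of quaternion matrices *)

Section QuatMatrixInverse.
Set Implicit Arguments.
Unset Strict Implicit.
Context {R : realType} {n : nat}.
Implicit Types (u : 'rV[quat R]_n) (V : 'M[quat R]_n) (w : 'rV[R]_(n * 4)).

Definition realify u : 'rV[R]_(n * 4) :=
  mxvec (\matrix_(j, k) qcoord k (u ord0 j)).

Definition unrealify w : 'rV[quat R]_n :=
  \row_j (row j (vec_mx w) : quat R).

Lemma realifyK : cancel realify unrealify.
Proof.
move=> u; apply/rowP => j; apply: qcoord_eq => k.
by rewrite /qcoord /unrealify /realify mxvecK !mxE.
Qed.

Lemma unrealifyK : cancel unrealify realify.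
Proof.
move=> w; rewrite -[RHS]vec_mxK; congr mxvec.
by apply/matrixP => j k; rewrite /qcoord !mxE.
Qed.

Lemma realify0 : realify 0 = 0.
Proof.
rewrite /realify -[RHS](linear0 mxvec); congr mxvec.
by apply/matrixP => j k; rewrite !mxE linear0.
Qed.

Definition real_mulmx V w : 'rV[R]_(n * 4) := realify (unrealify w *m V).

Lemma real_mulmx_is_linear V : linear (real_mulmx V).
Proof.
move=> a w1 w2; rewrite /real_mulmx /realify -linearP; congr mxvec.
apply/matrixP => j k; rewrite !mxE /= -linearP scaler_sumr -big_split /=.
congr (qcoord k _); apply: eq_bigr => i _; rewrite !mxE linearP /=.
rewrite scalerAl -mulrDl; congr (_ * _).
by apply/rowP => l; rewrite !mxE.
Qed.
HB.instance Definition _ V :=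
  GRing.isLinear.Build R _ _ *:%R (real_mulmx V) (real_mulmx_is_linear V).

(** Real dimension count: the real matrix of u |-> u V is square and has trivial
    kernel, so it is invertible, and solving for the rows of the identity gives
    a left inverse W. It is also a right inverse, since (V W - 1) V = 0 and V
    has no left kernel. *)
Lemma row_kernel0_inverse V : (forall u, u *m V = 0 -> u = 0) ->
  exists W, is_inverse_mx V W.
Proof.
move=> kerV; pose M := lin1_mx (real_mulmx V).
have M_unit : M \in unitmx.
  rewrite -row_free_unit; apply: inj_row_free => w.
  rewrite mul_rV_lin1 /= -realify0 => /(can_inj realifyK)/kerV w0.
  by rewrite -[w]unrealifyK w0 realify0.
pose W := \matrix_i unrealify (realify (row i 1%:M) *m invmx M).
have WV : W *m V = 1%:M.
  apply/row_matrixP => i; rewrite row_mul rowK.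
  rewrite -[LHS]realifyK -[realify _]/(real_mulmx V _) -mul_rV_lin1.
  by rewrite mulmxKV // realifyK.
exists W; split=> //; apply/subr0_eq/row_matrixP => i.
rewrite row0; apply: kerV.
by rewrite -row_mul mulmxBl -mulmxA WV mulmx1 mul1mx subrr row0.
Qed.

Lemma left_independentP (v : 'I_n -> 'rV[quat R]_n) :
  left_independent v <-> forall u, u *m (\matrix_i v i) = 0 -> u = 0.
Proof.
split=> [v_ind u|kerv q qv0 i].
  rewrite mulmx_sum_row => uv0; apply/rowP => i; rewrite mxE.
  by apply: v_ind => //; rewrite -[RHS]uv0; apply: eq_bigr => j _; rewrite rowK.
have /rowP/(_ i) : \row_j q j = 0.
  apply: kerv; rewrite mulmx_sum_row -[RHS]qv0; apply: eq_bigr => j _.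
  by rewrite rowK mxE.
by rewrite !mxE.
Qed.

End QuatMatrixInverse.

(** * Decoupling the system in a basis of eigenvectors *)

Section EigenvectorCoordinates.
Set Implicit Arguments.
Unset Strict Implicit.
Context {R : realType} {n : nat}.
Variables (A : 'M[quat R]_n) (lambda : 'I_n -> quat R).
Variable v : 'I_n -> 'rV[quat R]_n.
Implicit Types (x : R -> 'rV[quat R]_n) (t : R) (q : 'I_n -> quat R).

Lemma has_derivative_mulmx x t dx (W : 'M[quat R]_n) :
  has_derivative x t dx -> has_derivative (fun s => x s *m W) t (dx *m W).
Proof.
move=> Dx j.
change (is_qderive (fun s => (x s *m W) ord0 j) t ((dx *m W) ord0 j)).
rewrite mxE; under eq_fun do rewrite mxE.
apply: is_qderive_sum => i.
have := is_qderiveM (Dx i) (is_qderive_cst (W i j) t).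
by rewrite mulr0 addr0.
Qed.

Lemma exp_combE q t :
  exp_comb lambda v q t =
  (\row_i (q i * expq (t *: lambda i))) *m \matrix_i v i.
Proof. by rewrite mulmx_sum_row; apply: eq_bigr => i _; rewrite rowK mxE. Qed.

Lemma exp_comb_mulmx q t :
  exp_comb lambda v q t = (\row_i q i) *m exp_mx lambda v t.
Proof.
by rewrite mulmx_sum_row; apply: eq_bigr => i _; rewrite rowK mxE scalerA.
Qed.

(** Each row is rescaled by an invertible quaternion. *)
Lemma left_independent_exp t : left_independent v ->
  left_independent (fun i => expq (t *: lambda i) *: v i).
Proof.
move=> v_ind q qv0 i.
have qe0 : q i * expq (t *: lambda i) = 0.
  apply: (v_ind (fun i => q i * expq (t *: lambda i))); rewrite -[RHS]qv0.
  by apply: eq_bigr => j _; rewrite scalerA.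
have := expqNl (- lambda i) t; rewrite opprK => ee1.
by rewrite -[q i]mulr1 -ee1 mulrA qe0 mul0r.
Qed.

Hypothesis v_eigen : forall i, v i *m A = lambda i *: v i.

Lemma eigenvector_mx :
  (\matrix_i v i) *m A = diag_mx (\row_i lambda i) *m \matrix_i v i.
Proof.
apply/row_matrixP => i; rewrite row_mul rowK v_eigen.
by apply/rowP => j; rewrite mul_diag_mx !mxE.
Qed.

(** Differentiation puts lambda_i between q_i and e^(lambda_i t), whereas A acts
    by lambda_i next to v_i; the two agree because lambda_i commutes with its
    own exponential. *)
Lemma exp_comb_solution q : left_solution A (exp_comb lambda v q).
Proof.
move=> t.
have -> : exp_comb lambda v q =
    fun s => (\row_i (q i * expq (s *: lambda i))) *m \matrix_i v i.
  by apply/funext => s; exact: exp_combE.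
rewrite -mulmxA eigenvector_mx mulmxA; apply: has_derivative_mulmx => j.
change (is_qderive (fun s => (\row_i (q i * expq (s *: lambda i))) ord0 j) t
  ((\row_i (q i * expq (t *: lambda i)) *m diag_mx (\row_i lambda i)) ord0 j)).
rewrite mul_mx_diag !mxE; under eq_fun do rewrite mxE.
have := is_qderiveM (is_qderive_cst (q j) t) (is_qderive_expq (lambda j) t).
by rewrite mul0r add0r expq_comm mulrA.
Qed.

(** In the coordinates x W, where A acts as the diagonal matrix of the
    eigenvalues, each entry solves a scalar equation. *)
Lemma solution_exp_comb x (W : 'M[quat R]_n) :
  is_inverse_mx (\matrix_i v i) W -> left_solution A x ->
  forall t, x t = exp_comb lambda v (fun i => (x 0 *m W) ord0 i) t.
Proof.
move=> [VW WV] xA t.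
rewrite exp_combE -[LHS]mulmx1 -WV mulmxA; congr (_ *m _).
apply/rowP => i; rewrite [RHS]mxE.
apply: (@scalar_ode_sol _ (lambda i) (fun s => (x s *m W) ord0 i)) => s.
have AW : A *m W = W *m diag_mx (\row_i lambda i).
  rewrite -[LHS]mul1mx -WV -mulmxA [X in W *m X]mulmxA eigenvector_mx.
  by rewrite -mulmxA VW mulmx1.
have <- : (x s *m A *m W) ord0 i = (x s *m W) ord0 i * lambda i.
  rewrite -mulmxA AW mulmxA mul_mx_diag [LHS]mxE; congr (_ * _).
  by rewrite mxE.
exact: has_derivative_mulmx W (xA s) i.
Qed.

End EigenvectorCoordinates.

(** * The general solution *)

(** If A = P D P^-1 then P^-1 A = D P^-1: the rows of P^-1 are eigenvectors, with
    the diagonal entries of D as eigenvalues. *)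
Lemma diagonalizable_row_eigenvectors (R : realType) (n : nat)
    (A : 'M[quat R]_n) : diagonalizable_mx A ->
  exists (lambda : 'I_n -> quat R) (v : 'I_n -> 'rV[quat R]_n),
    (forall i, row_eigenvector A (lambda i) (v i)) /\ left_independent v.
Proof.
move=> [P [Q [D [[PQ QP] /diag_mxP[d ->] ->]]]].
have ker0 (u : 'rV_n) : u *m Q = 0 -> u = 0.
  by move=> uQ0; rewrite -[u]mulmx1 -QP mulmxA uQ0 mul0mx.
exists (fun i => d ord0 i), (fun i => row i Q); split=> [i|].
  split.
    apply/eqP; rewrite -[Q]mul1mx row_mul => /ker0 /rowP/(_ i)/eqP.
    by rewrite !mxE eqxx oner_eq0.
  rewrite -row_mul !mulmxA QP mul1mx.
  by apply/rowP => j; rewrite mul_diag_mx !mxE.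
apply/left_independentP => u uQ0; apply: ker0; rewrite -[RHS]uQ0; congr (_ *m _).
by apply/row_matrixP => i; rewrite rowK.
Qed.

Theorem theorem3p12 (R : realType) (n : nat) (A : 'M[quat R]_n)
    (hA : diagonalizable_mx A) :
  (exists (lambda : 'I_n -> quat R) (v : 'I_n -> 'rV[quat R]_n),
      (forall i, row_eigenvector A (lambda i) (v i)) /\ left_independent v) /\
  (forall (lambda : 'I_n -> quat R) (v : 'I_n -> 'rV[quat R]_n),
      (forall i, row_eigenvector A (lambda i) (v i)) -> left_independent v ->
    (forall x : R -> 'rV[quat R]_n,
        left_solution A x <->
        exists q : 'I_n -> quat R, forall t, x t = exp_comb lambda v q t) /\
    fundamental_matrix A (exp_mx lambda v) /\
    (forall (t0 : R) (x0 : 'rV[quat R]_n),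
        (exists! x : R -> 'rV[quat R]_n, left_ivp_solution A t0 x0 x) /\
        (exists q : 'I_n -> quat R, x0 = exp_comb lambda v q t0) /\
        (exists Y : 'M[quat R]_n, is_inverse_mx (exp_mx lambda v t0) Y) /\
        (forall x : R -> 'rV[quat R]_n, left_ivp_solution A t0 x0 x ->
          (forall q : 'I_n -> quat R, x0 = exp_comb lambda v q t0 ->
            forall t, x t = exp_comb lambda v q t) /\
          (forall Y : 'M[quat R]_n, is_inverse_mx (exp_mx lambda v t0) Y ->
            forall t, x t = x0 *m Y *m exp_mx lambda v t)))).
Proof.
split; first exact: diagonalizable_row_eigenvectors.
move=> lambda v v_row_eigen v_ind.
have v_eigen i : v i *m A = lambda i *: v i by have [] := v_row_eigen i.
have exp_ind t := @left_independent_exp R n lambda v t v_ind.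
have [W VW] := row_kernel0_inverse ((left_independentP v).1 v_ind).
have solP x : left_solution A x <->
    exists q : 'I_n -> quat R, forall t, x t = exp_comb lambda v q t.
  split=> [xA|[q /funext ->]]; last exact: exp_comb_solution.
  by eexists; exact: solution_exp_comb VW xA.
split=> //; split.
  split=> [i|q q0].
    (* Row i of X is the combination with constants (0, ..., 1, ..., 0). *)
    apply/solP; exists (fun j => (j == i)%:R) => t.
    rewrite exp_comb_mulmx rowE; congr (_ *m _).
    by apply/rowP => j; rewrite !mxE eqxx.
  apply: (exp_ind 0); rewrite -[RHS](q0 0).
  by apply: eq_bigr => i _; rewrite rowK.
move=> t0 x0.
have [Y XY] := row_kernel0_inverse ((left_independentP _).1 (exp_ind t0)).
pose q0 i := (x0 *m Y) ord0 i.
have q0E : x0 = exp_comb lambda v q0 t0.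
  rewrite exp_comb_mulmx.
  have -> : \row_i q0 i = x0 *m Y by apply/rowP => i; rewrite mxE.
  by rewrite -mulmxA XY.2 mulmx1.
(* The value at t0 determines the constants: this gives uniqueness and also
   identifies x0 X(t0)^-1 with the row of constants. *)
have combK Z q : is_inverse_mx (exp_mx lambda v t0) Z ->
    exp_comb lambda v q t0 *m Z = \row_i q i.
  by move=> [XZ _]; rewrite exp_comb_mulmx -mulmxA XZ mulmx1.
have ivpE x q : left_ivp_solution A t0 x0 x -> x0 = exp_comb lambda v q t0 ->
    forall t, x t = exp_comb lambda v q t.
  move=> [/solP[p xE] xt0] x0E t.
  by rewrite xE !exp_comb_mulmx -!(combK Y) // -x0E -xt0 xE.
split.
  exists (exp_comb lambda v q0); split=> [|x xA].
    by split; first exact: exp_comb_solution.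
  by apply/funext => t; rewrite (ivpE x q0).
split; first by exists q0.
split; first by exists Y.
move=> x xA; split=> [q|Z XZ t]; first exact: ivpE.
by rewrite (ivpE x q0) // exp_comb_mulmx -(combK Z) // -q0E.
Qed.
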